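(* Let $T^2=\mathbb R^2/\mathbb Z^2$, let $\sim$ be the equivalence relation on $T^2$ given by $p\sim -p$, let $S^2=T^2/{\sim}$ (a two-dimensional sphere) with projection $\pi\colon T^2\to S^2$, let $\tilde f\colon T^2\to T^2$ be $\tilde f(x,y)=(2x+y,x+y)$, and let $f\colon S^2\to S^2$ be the homeomorphism with $f(\pi(p))=\pi(\tilde f(p))$ for all $p\in T^2$. Then for all $\epsilon>0$ there is a Cantor set $C\subset S^2$ such that $\operatorname{diam}(f^n(C))\le\epsilon$ for all $n\in\mathbb Z$. In particular, $f$ is not $N$-expansive, for every $N\ge1$.
   Context: $S^2$ carries any metric compatible with its topology. A homeomorphism $f\colon X\to X$ of a compact metric space is $N$-expansive if there is $\delta>0$ such that if $A\subset X$ is an arbitrary subset with $\operatorname{diam}(f^n(A))\le\delta$ for all $n\in\mathbb Z$ then $A$ has at most $N$ points. *)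

(* Defs.v *)
From HB Require Import structures.
From mathcomp Require Import all_boot all_order all_algebra.
From mathcomp Require Import generic_quotient ring_quotient.
From mathcomp Require Import all_classical all_reals all_analysis.
From mathcomp Require Import ring.

Set Implicit Arguments.
Unset Strict Implicit.
Unset Printing Implicit Defensive.

Import Order.TTheory GRing.Theory Num.Theory.
Import numFieldNormedType.Exports.

Local Open Scope classical_set_scope.
Local Open Scope ring_scope.
Local Open Scope quotient_scope.

Record homeo (X Y : topologicalType) := Homeo {
  homeo_fun :> X -> Y;
  homeo_inv : Y -> X;
  homeoK : cancel homeo_fun homeo_inv;
  homeoVK : cancel homeo_inv homeo_fun;
  homeo_continuous : continuous homeo_fun;
  homeo_inv_continuous : continuous homeo_inv
}.

(* The power f^n for n in Z: [Negz k] is the integer - k.+1. *)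
Definition iterz (X : topologicalType) (f : homeo X X) (n : int) : X -> X :=
  match n with
  | Posz k => iter k f
  | Negz k => iter k.+1 (homeo_inv f)
  end.

(* [C] carries the subspace topology of [set_type C]. *)
Definition is_cantor_set (X : topologicalType) (C : set X) : Prop :=
  inhabited (homeo cantor_space C).

(* A distance function inducing the given topology of [X]. *)
Record compatible_metric (R : realType) (X : topologicalType)
    (d : X -> X -> R) : Prop := CompatibleMetric {
  metric_eq0 : forall x y, d x y = 0 <-> x = y;
  metric_symmetric : forall x y, d x y = d y x;
  metric_triangular : forall x y z, d x z <= d x y + d y z;
  metric_nbhs : forall (x : X) (U : set X),
    nbhs x U <-> exists2 r, 0 < r & [set y | d x y < r] `<=` U
}.

(* Extended-real valued, with [diam d set0 = -oo]; only upper bounds on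
   diameters are used. *)
Definition diam (R : realType) (X : Type) (d : X -> X -> R) (A : set X) :
    \bar R :=
  ereal_sup [set (d p.1 p.2)%:E | p in A `*` A].

Definition N_expansive (R : realType) (X : topologicalType) (d : X -> X -> R)
    (f : homeo X X) (N : nat) : Prop :=
  exists2 delta : R, 0 < delta &
    forall A : set X,
      (forall n : int, (diam d (iterz f n @` A) <= delta%:E)%E) ->
      (A #<= `I_N)%card.

Section torus.
Variable R : realType.

Definition Z2 : {pred R * R} :=
  fun v => (v.1 \is a Num.int) && (v.2 \is a Num.int).

Fact Z2_zmod_closed : zmod_closed Z2.
Proof.
split=> [|u v]; first by rewrite /in_mem /= /Z2 /= !rpred0.
rewrite /in_mem /= /Z2 => /andP[u1 u2] /andP[v1 v2] /=.
by rewrite !rpredB.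
Qed.

HB.instance Definition _ := GRing.isZmodClosed.Build (R * R)%type Z2
  Z2_zmod_closed.

Let quot_Z2 := Quotient.quot Z2.

Definition torus : Type := quotient_topology quot_Z2.

HB.instance Definition _ := Topological.on torus.
HB.instance Definition _ := Quotient.on torus.
(* [quotient_topology] forgets the group structure of [Quotient.quot Z2]. *)
HB.instance Definition _ := GRing.isZmodule.Build torus
  (@addrA quot_Z2) (@addrC quot_Z2) (@add0r quot_Z2) (@addNr quot_Z2).

Definition pi_torus : R * R -> torus := \pi_torus.

(* Lift to R^2 of the toral automorphism and of its inverse. *)
Definition cat_lin (v : R * R) : R * R := (2 * v.1 + v.2, v.1 + v.2).
Definition cat_lin_inv (v : R * R) : R * R := (v.1 - v.2, 2 * v.2 - v.1).

Definition cat_map (p : torus) : torus := pi_torus (cat_lin (repr p)).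
Definition cat_map_inv (p : torus) : torus := pi_torus (cat_lin_inv (repr p)).

Definition pm_rel (p q : torus) : bool := (q == p) || (q == - p).

Fact pm_rel_equiv : equiv_class_of pm_rel.
Proof.
split=> [p|p q|q p r].
- by rewrite /pm_rel eqxx.
- by rewrite /pm_rel (eq_sym q) -(inj_eq oppr_inj q) opprK (eq_sym (- q)).
- rewrite /pm_rel => /orP[]/eqP-> /orP[]/eqP->;
  by rewrite ?opprK eqxx ?orbT.
Qed.

Canonical pm_equiv := EquivRelPack pm_rel_equiv.

Definition S2 : Type := quotient_topology {eq_quot pm_equiv}.

HB.instance Definition _ := Topological.on S2.
HB.instance Definition _ := Quotient.on S2.

Definition pi_S2 : torus -> S2 := \pi_S2.

Lemma pi_torus_eqP (u v : R * R) :
  pi_torus u = pi_torus v <-> u - v \in Z2.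
Proof.
rewrite Quotient.idealrBE; split=> [h|/eqP h]; last exact: h.
by apply/eqP.
Qed.

Lemma pi_torusN (v : R * R) : pi_torus (- v) = - pi_torus v.
Proof. exact: (raddfN (\pi_quot_Z2)). Qed.

Lemma pi_torusD (u v : R * R) : pi_torus (u + v) = pi_torus u + pi_torus v.
Proof. exact: (raddfD (\pi_quot_Z2)). Qed.

Lemma torusW (P : torus -> Prop) : (forall v, P (pi_torus v)) -> forall p, P p.
Proof. by move=> h p; rewrite -[p]reprK; exact: h. Qed.

Lemma S2W (P : S2 -> Prop) : (forall p, P (pi_S2 p)) -> forall z, P z.
Proof. by move=> h z; rewrite -[z]reprK; exact: h. Qed.

Lemma pi_S2_eqP (p q : torus) : pi_S2 p = pi_S2 q <-> q = p \/ q = - p.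
Proof.
split=> [/eqmodP/orP[]/eqP|h]; [by left|by right|].
by apply/eqmodP/orP; case: h => /eqP; [left|right].
Qed.

Lemma cat_mapE (v : R * R) : cat_map (pi_torus v) = pi_torus (cat_lin v).
Proof.
apply/pi_torus_eqP.
have /pi_torus_eqP : pi_torus (repr (pi_torus v)) = pi_torus v by exact: reprK.
set u := repr _; rewrite /in_mem /= /Z2 /= => /andP[h1 h2].
have -> : 2 * u.1 + u.2 - (2 * v.1 + v.2) =
  (u.1 - v.1) + (u.1 - v.1) + (u.2 - v.2) by ring.
have -> : u.1 + u.2 - (v.1 + v.2) = (u.1 - v.1) + (u.2 - v.2) by ring.
by rewrite (rpredD (rpredD h1 h1) h2) (rpredD h1 h2).
Qed.

Lemma cat_map_invE (v : R * R) :
  cat_map_inv (pi_torus v) = pi_torus (cat_lin_inv v).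
Proof.
apply/pi_torus_eqP.
have /pi_torus_eqP : pi_torus (repr (pi_torus v)) = pi_torus v by exact: reprK.
set u := repr _; rewrite /in_mem /= /Z2 /= => /andP[h1 h2].
have -> : u.1 - u.2 - (v.1 - v.2) = (u.1 - v.1) - (u.2 - v.2) by ring.
have -> : 2 * u.2 - u.1 - (2 * v.2 - v.1) =
  (u.2 - v.2) + (u.2 - v.2) - (u.1 - v.1) by ring.
by rewrite (rpredB h1 h2) (rpredB (rpredD h2 h2) h1).
Qed.

Lemma cat_mapN (p : torus) : cat_map (- p) = - cat_map p.
Proof.
elim/torusW: p => v; rewrite -pi_torusN !cat_mapE -pi_torusN.
by congr pi_torus; congr pair => /=; ring.
Qed.

Lemma cat_map_invN (p : torus) : cat_map_inv (- p) = - cat_map_inv p.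
Proof.
elim/torusW: p => v; rewrite -pi_torusN !cat_map_invE -pi_torusN.
by congr pi_torus; congr pair => /=; ring.
Qed.

Lemma cat_mapK : cancel cat_map cat_map_inv.
Proof.
elim/torusW=> v; rewrite cat_mapE cat_map_invE; congr pi_torus.
by case: v => x y; congr pair => /=; ring.
Qed.

Lemma cat_map_invK : cancel cat_map_inv cat_map.
Proof.
elim/torusW=> v; rewrite cat_map_invE cat_mapE; congr pi_torus.
by case: v => x y; congr pair => /=; ring.
Qed.

Let cvg_lin (a b : R) (v : R * R) :
  (fun w : R * R => a * w.1 + b * w.2) @ v --> a * v.1 + b * v.2.
Proof.
by apply: cvgD; apply: cvgM; [exact: cvg_cst|exact: cvg_fst
  |exact: cvg_cst|exact: cvg_snd].
Qed.

Let continuous_lin (a b c d : R) :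
  continuous (fun v : R * R => (a * v.1 + b * v.2, c * v.1 + d * v.2)).
Proof.
by move=> v; apply: cvg_pair (@cvg_lin a b v) (@cvg_lin c d v).
Qed.

Lemma cat_map_continuous : continuous cat_map.
Proof.
apply/(@quotient_continuous _ quot_Z2).
have -> : cat_map \o \pi_torus = \pi_torus \o
    (fun v => (2 * v.1 + 1 * v.2, 1 * v.1 + 1 * v.2)).
  by apply/funext => v /=; rewrite !mul1r; exact: cat_mapE.
move=> v; apply: continuous_comp; last exact: pi_continuous.
exact: continuous_lin.
Qed.

Lemma cat_map_inv_continuous : continuous cat_map_inv.
Proof.
apply/(@quotient_continuous _ quot_Z2).
have -> : cat_map_inv \o \pi_torus = \pi_torus \o
    (fun v => (1 * v.1 + (- 1) * v.2, (- 1) * v.1 + 2 * v.2)).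
  apply/funext => v /=; rewrite !mul1r !mulN1r [- _ + 2 * _]addrC.
  exact: cat_map_invE.
move=> v; apply: continuous_comp; last exact: pi_continuous.
exact: continuous_lin.
Qed.

(* The map induced on the quotient by a map [g] commuting with [-]. *)
Definition S2_lift (g : torus -> torus) (z : S2) : S2 := pi_S2 (g (repr z)).

Lemma S2_lift_pi (g : torus -> torus) (p : torus) :
  (forall q, g (- q) = - g q) -> S2_lift g (pi_S2 p) = pi_S2 (g p).
Proof.
move=> gN; rewrite /S2_lift; apply/pi_S2_eqP.
have /pi_S2_eqP : pi_S2 (repr (pi_S2 p)) = pi_S2 p by exact: reprK.
by move: (repr _) => q [->|->]; [left|right; exact: gN].
Qed.

Lemma S2_lift_continuous (g : torus -> torus) :
  (forall q, g (- q) = - g q) -> continuous g -> continuous (S2_lift g).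
Proof.
move=> gN gc; apply/(@quotient_continuous _ {eq_quot pm_equiv}).
have -> : S2_lift g \o \pi_S2 = \pi_S2 \o g.
  by apply/funext => v; exact: S2_lift_pi.
by move=> v; apply: continuous_comp; [exact: gc|exact: pi_continuous].
Qed.

Fact S2_funK : cancel (S2_lift cat_map) (S2_lift cat_map_inv).
Proof.
elim/S2W=> p; rewrite (S2_lift_pi _ cat_mapN) (S2_lift_pi _ cat_map_invN).
by rewrite cat_mapK.
Qed.

Fact S2_fun_invK : cancel (S2_lift cat_map_inv) (S2_lift cat_map).
Proof.
elim/S2W=> p; rewrite (S2_lift_pi _ cat_map_invN) (S2_lift_pi _ cat_mapN).
by rewrite cat_map_invK.
Qed.

Definition S2_homeo : homeo S2 S2 :=
  Homeo S2_funK S2_fun_invK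
    (S2_lift_continuous cat_mapN cat_map_continuous)
    (S2_lift_continuous cat_map_invN cat_map_inv_continuous).

Lemma S2_homeoE (p : torus) : S2_homeo (pi_S2 p) = pi_S2 (cat_map p).
Proof. exact: (S2_lift_pi _ cat_mapN). Qed.

Lemma torus_compact : compact [set: torus].
Proof.
have -> : [set: torus] = pi_torus @` (`[0, 1] `*` `[0, 1]).
  apply/seteqP; split=> // p _; elim/torusW: p => -[x y].
  exists (x - (Num.floor x)%:~R, y - (Num.floor y)%:~R).
    have frac (z : R) : z - (Num.floor z)%:~R \in `[0, 1].
      rewrite in_itv /= subr_ge0 floor_le lerBlDl -(intrD _ _ 1) ltW //.
      exact: floorD1_gt.
    by split; exact: frac.
  apply/pi_torus_eqP; rewrite /in_mem /= /Z2 /=.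
  have fracB (z : R) : z - (Num.floor z)%:~R - z = - (Num.floor z)%:~R by ring.
  by rewrite !fracB !rpredN !intr_int.
apply: continuous_compact; last by apply: compact_setX; exact: segment_compact.
by apply: continuous_subspaceT; exact: pi_continuous.
Qed.

Lemma S2_compact : compact [set: S2].
Proof.
have -> : [set: S2] = pi_S2 @` [set: torus].
  by apply/seteqP; split=> // z _; elim/S2W: z => p; exists p.
apply: continuous_compact; last exact: torus_compact.
by apply: continuous_subspaceT; exact: pi_continuous.
Qed.

End torus.

(* Main.v *)
(* Let v_u and v_s be eigenvectors of the cat map for the eigenvalues lambda > 1
   and 1 / lambda, scaled so that v_u - v_s = (1, 0): on the torus v_u and v_s
   are the same point, which is homoclinic to 0. For a sign sequence s and a
   large even m, take the point p_s = (sum_k s_k lambda^(- m k)) v_u. At time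
   m j the term of index k < j, which has grown to a positive power of lambda
   times v_u, may be replaced on the torus by the corresponding multiple of
   v_s, which contracts. So at every time all terms but one are uniformly small,
   and the remaining one is a known point multiplied by one of the signs s_k,
   which is erased by the projection to S^2. Hence the orbits of all the p_s
   stay uniformly close in S^2. Imposing s_0 = + makes s |-> p_s injective in
   S^2, and its range is a Cantor set. *)
Require Import Defs.
From mathcomp Require Import all_boot all_order all_algebra.
From mathcomp Require Import all_classical all_reals all_analysis.
From mathcomp Require Import ring lra.

Import Order.TTheory GRing.Theory Num.Theory.
Import numFieldNormedType.Exports.

Local Open Scope classical_set_scope.
Local Open Scope ring_scope.

(** * Cantor sets and compatible metrics *)

(** Compactness against Hausdorffness: the inverse pulls a closed set back to the image of a compact
    set, which is closed. *)
Lemma cantor_set_range (X : topologicalType) (g : cantor_space -> X) :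
  hausdorff_space X -> continuous g -> injective g -> is_cantor_set (range g).
Proof.
move=> hX gc gI.
have gr s : g s \in range g by apply/mem_set; exists s.
pose f s : range g := exist (fun x => x \in range g) (g s) (gr s).
have ex (y : range g) : {s | g s = set_val y}.
  by apply: cid; have [s _ e] := set_valP y; exists s.
pose h y := projT1 (ex y).
have hE y : g (h y) = set_val y by rewrite /h; case: (ex y).
have fK : cancel f h by move=> s; apply: gI; rewrite hE set_valE.
have hK : cancel h f by move=> y; apply/val_inj; exact: hE.
have fc : continuous f by apply: continuous_comp_initial.
split; apply: (Homeo fK hK fc).
apply/continuous_closedP => A cA.
have -> : h @^-1` A = set_val @^-1` (g @` A).
  apply/seteqP; split => y /=; first by move=> Ay; exists (h y).
  by case=> s As /esym; rewrite -hE => /gI ->.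
apply: closed_comp => [y _|]; first exact: initial_continuous.
apply: compact_closed => //; apply: continuous_compact.
  exact: continuous_subspaceT.
exact: (subclosed_compact cA cantor_space_compact).
Qed.

Lemma cantor_set_card (X : topologicalType) (C : set X) (N : nat) :
  is_cantor_set C -> ~ (C #<= `I_N)%card.
Proof.
case=> h CN.
(* The indicator sequences of single indices already give N + 1 distinct points. *)
pose f k := set_val (h (fun n => n == k)).
have fI : injective f.
  move=> i j /val_inj/(can_inj (homeoK h))/(congr1 (@^~ i)).
  by rewrite eqxx => /esym/eqP.
have fC : f @` `I_N.+1 `<=` C by move=> _ [k _ <-]; exact: set_valP.
have := card_le_trans (subset_card_le fC) CN.
by rewrite (card_le_eql (inj_card_eq (in2W fI))) card_le_II ltnn.
Qed.

Lemma compatible_metric_hausdorff (R : realType) (X : topologicalType)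
  (d : X -> X -> R) : compatible_metric d -> hausdorff_space X.
Proof.
move=> dm p q clpq; apply/(metric_eq0 dm)/eqP; rewrite eq_le.
have d0 x y : 0 <= d x y.
  have := metric_triangular dm x y x.
  by rewrite (metric_eq0 dm x x).2 // (metric_symmetric dm y x); lra.
rewrite d0 andbT; apply/ler_addgt0Pl => e e0; rewrite addr0.
have e2 : 0 < e / 2 by lra.
have nb x : nbhs x [set y | d x y < e / 2]
  by apply/(metric_nbhs dm); exists (e / 2).
have [z [/= pz qz]] := clpq _ _ (nb p) (nb q).
have := metric_triangular dm p z q; rewrite (metric_symmetric dm z q); lra.
Qed.

(** * Geometric series with signs *)

(** The boolean [s k] is used as an exponent, so [false] is the sign +. *)
Definition sign_series {R : realType} (mu : R) (s : nat -> bool) : R :=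
  limn (series (fun k => (-1) ^+ s k * mu ^+ k)).

Section sign_series.
Context {R : realType} (mu : R).
Hypotheses (mu_gt0 : 0 < mu) (mu_le : 20 * mu <= 1).
Implicit Types s t : nat -> bool.

Let mu_ge0 : 0 <= mu := ltW mu_gt0.

Let normed_sign_series s :
  [normed series (fun k => (-1) ^+ s k * mu ^+ k)] = series (geometric 1 mu).
Proof.
apply/funext => n; apply: eq_bigr => k _ /=.
by rewrite normrMsign normrX ger0_norm //= mul1r.
Qed.

Let mu_norm : `|mu| < 1.
Proof. by rewrite (ger0_norm mu_ge0); move: mu_gt0 mu_le; lra. Qed.

Lemma sign_series_cvg s :
  series (fun k => (-1) ^+ s k * mu ^+ k) @ \oo --> sign_series mu s.
Proof.
apply: normed_cvg; rewrite normed_sign_series.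
exact: is_cvg_geometric_series.
Qed.

(** This recursion turns an expansion by 1 / [mu] into a shift of the signs. *)
Lemma sign_seriesE s :
  sign_series mu s = (-1) ^+ s 0%N + mu * sign_series mu (s \o succn).
Proof.
have := sign_series_cvg s; rewrite -cvg_shiftS => /cvg_lim <- //.
apply: cvg_lim => //.
under eq_fun do rewrite /series /= big_nat_recl // expr0 mulr1.
apply: cvgD; first exact: cvg_cst.
under eq_fun do under eq_bigr do rewrite exprS mulrCA.
under eq_fun do rewrite -mulr_sumr.
by apply: cvgM; [exact: cvg_cst|exact: sign_series_cvg].
Qed.

Lemma sign_series_le s : `|sign_series mu s| <= 2.
Proof.
apply: le_trans (lim_series_norm _) _; rewrite normed_sign_series.
  exact: is_cvg_geometric_series.
rewrite (cvg_lim _ (cvg_geometric_series mu_norm)) // mul1r.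
by rewrite -[leRHS]invrK lef_pV2 ?posrE; move: mu_gt0 mu_le; lra.
Qed.

Lemma mul_sign_series_le s : `|mu * sign_series mu s| <= 2 * mu.
Proof.
rewrite normrM (ger0_norm mu_ge0) mulrC.
by apply: ler_wpM2r => //; exact: sign_series_le.
Qed.

(** The leading sign outweighs the tail, which is at most 2 [mu], so it can be read off the sum;
    cancelling it and dividing by [mu] exposes the next sign. *)
Lemma sign_series_inj : injective (sign_series mu).
Proof.
suff h n s t : sign_series mu s = sign_series mu t -> s n = t n.
  by move=> s t st; apply/funext => n; exact: h.
elim: n s t => [|n IHn] s t;
  have := mul_sign_series_le (s \o succn);
  have := mul_sign_series_le (t \o succn);
  rewrite (sign_seriesE s) (sign_seriesE t) !ler_norml.
  by case: (s 0%N); case: (t 0%N) => //; rewrite ?expr0 ?expr1;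
    move: mu_gt0 mu_le; lra.
move=> ht hs st; apply: (IHn (s \o succn) (t \o succn)).
apply: (mulfI (lt0r_neq0 mu_gt0)).
move: mu_gt0 mu_le st ht hs.
by case: (s 0%N); case: (t 0%N); rewrite ?expr0 ?expr1; lra.
Qed.

Lemma sign_series_near s t n : (forall k, (k < n)%N -> s k = t k) ->
  `|sign_series mu s - sign_series mu t| <= 4 * mu ^+ n.
Proof.
elim: n s t => [|n IHn] s t st.
  have := sign_series_le s; have := sign_series_le t.
  by rewrite expr0 !ler_norml; lra.
rewrite (sign_seriesE s) (sign_seriesE t) st // opprD addrACA subrr add0r.
rewrite -mulrBr normrM (ger0_norm mu_ge0) exprS mulrCA; apply: ler_wpM2l => //.
by apply: IHn => k kn; exact: st.
Qed.

Lemma sign_series_continuous :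
  continuous (sign_series mu : cantor_space -> R).
Proof.
move=> s; apply/cvgrPdist_lt => e e0.
have : (fun n => 4 * mu ^+ n) @ \oo --> 4 * (0 : R).
  by apply: cvgM; [exact: cvg_cst|exact: cvg_expr].
rewrite mulr0 => /cvgr0Pnorm_lt/(_ _ e0)[n _ /(_ n (leqnn n))] /= hn.
(* Agreement on the first [n] coordinates is a finite intersection of cylinders. *)
have st : nbhs s [set t : cantor_space | forall k : 'I_n, s k = t k].
  pose agree (k : 'I_n) : set cantor_space := [set t | s k = t k].
  apply: (@filter_forall _ _ agree (nbhs (s : cantor_space)) _) => k.
  have /(_ [set s k] (discrete_set1 _)) :=
    @proj_continuous nat (fun=> bool) k s.
  by apply: filterS => t /esym.
apply: filterS st => t st; apply: le_lt_trans hn.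
rewrite [leRHS]ger0_norm ?mulr_ge0 ?exprn_ge0 //.
by apply: sign_series_near => k kn; exact: (st (Ordinal kn)).
Qed.

End sign_series.

(** * Uniform continuity for a compatible metric *)

Lemma compatible_metric_uniform (R : realType) (V : pseudoMetricType R)
    (X : topologicalType) (d : X -> X -> R) (K : set V) (g : V -> X) (e : R) :
    compatible_metric d -> compact K -> continuous g -> 0 < e ->
  exists2 r, 0 < r & forall u v, K u -> ball u r v -> d (g u) (g v) < e.
Proof.
move=> dm /compact_near_coveringP cK gc e0.
pose P r u := forall v, ball u r v -> d (g u) (g v) < e.
have [] := cK _ 0^'+ P.
  move=> u _.
  have nu : nbhs (g u) [set y | d (g u) y < e / 2].
    by apply/(metric_nbhs dm); exists (e / 2) => //; lra.
  have /nbhs_ballP[r /= r0 ur] := gc u _ nu.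
  have r2 : 0 < r / 2 by lra.
  (* Halving keeps both [w] and [v] in the ball of radius [r] about [u], so both images are within e
     / 2 of [g u]. *)
  exists (ball u (r / 2), [set t | t < r / 2]) => /=.
    by split; [exact: nbhsx_ballx|exact: nbhs_right_lt].
  move=> [w t] /= [uw tr] v wv.
  have w2 := ur w (le_ball (ltac:(lra) : r / 2 <= r) uw).
  have rE : r = r / 2 + r / 2 by lra.
  have v2 : d (g u) (g v) < e / 2.
    by apply: ur; rewrite /= rE; apply: ball_triangle uw (le_ball (ltW tr) wv).
  move: w2 v2 => /=; have := metric_triangular dm (g w) (g u) (g v).
  rewrite (metric_symmetric dm (g w) (g u)); lra.
move=> r /= r0 h; exists (r / 2); first lra.
move=> u v Ku.
by apply: (h (r / 2)) => //=; rewrite ?sub0r ?normrN ?gtr0_norm; lra.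
Qed.

(** * Eigenvector coordinates on the sphere *)

Section eigen_coordinates.
Variable R : realType.
Implicit Types a b x y : R.

Let s : R := Num.sqrt 5.

Definition cat_expansion : R := (3 + s) / 2.
Definition cat_contraction : R := (3 - s) / 2.

Let s2 : s * s = 5. Proof. by rewrite -expr2 sqr_sqrtr. Qed.

Let s_ge0 : 0 <= s. Proof. exact: sqrtr_ge0. Qed.

(** The constant is twice the 11 / 10 of [S2_pt_inj]; its square is 4.84. *)
Lemma sqrt5_gt : 11 / 5 < s.
Proof.
rewrite ltNge; apply/negP => h.
have := s2; have : s * s <= 11 / 5 * (11 / 5) by apply: ler_pM.
lra.
Qed.

Lemma sqrt5_lt : s < 3.
Proof.
rewrite ltNge; apply/negP => h.
have := s2; have : 3 * 3 <= s * s by apply: ler_pM.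
lra.
Qed.

Lemma cat_expansionK : cat_expansion * cat_contraction = 1.
Proof. by rewrite /cat_expansion /cat_contraction; have := s2; lra. Qed.

Lemma cat_contraction_gt0 : 0 < cat_contraction.
Proof. by rewrite /cat_contraction; have := sqrt5_lt; lra. Qed.

Lemma cat_contraction_lt : cat_contraction < 1 / 2.
Proof. by rewrite /cat_contraction; have := sqrt5_gt; lra. Qed.

(* [a v_u + b v_s], where v_u = (1 / 2 + s / 10, s / 5) and v_s = v_u - (1, 0)
   are eigenvectors of [cat_lin]; note that s / 5 = 1 / s. *)
Definition eigen_pt a b : R * R :=
  ((a - b) / 2 + (a + b) * s / 10, (a + b) * s / 5).

Lemma cat_lin_eigen a b :
  cat_lin (eigen_pt a b) = eigen_pt (cat_expansion * a) (cat_contraction * b).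
Proof.
rewrite /cat_lin /eigen_pt /cat_expansion /cat_contraction /=.
congr pair; first by field: s2.
by field: s2.
Qed.

Lemma cat_lin_inv_eigen a b :
  cat_lin_inv (eigen_pt a b) =
  eigen_pt (cat_contraction * a) (cat_expansion * b).
Proof.
rewrite /cat_lin_inv /eigen_pt /cat_expansion /cat_contraction /=.
congr pair; first by field: s2.
by field: s2.
Qed.

Definition S2_pt a b : S2 R := pi_S2 (pi_torus (eigen_pt a b)).

Lemma S2_ptN a b : S2_pt (- a) (- b) = S2_pt a b.
Proof.
apply/pi_S2_eqP; right; rewrite -pi_torusN; congr pi_torus.
by congr pair => /=; ring.
Qed.

(** Since [v_u - v_s] is a lattice vector, a unit of the expanding coordinate can be traded for a
    unit of the contracting one. *)
Lemma S2_pt_slide a b : S2_pt (1 + a) b = S2_pt a (1 + b).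
Proof.
congr pi_S2; apply/pi_torus_eqP; apply/andP => /=.
have -> : (1 + a - b) / 2 + (1 + a + b) * s / 10 -
  ((a - (1 + b)) / 2 + (a + (1 + b)) * s / 10) = 1 by field.
have -> : (1 + a + b) * s / 5 - (a + (1 + b)) * s / 5 = 0 by ring.
by split; rewrite ?rpred0 ?rpred1.
Qed.

Lemma S2_pt_sign (e : bool) a b :
  S2_pt ((-1) ^+ e * a) ((-1) ^+ e * b) = S2_pt a b.
Proof. by case: e; rewrite ?mul1r // !mulN1r S2_ptN. Qed.

Lemma S2_pt_slide_sign (e : bool) a b :
  S2_pt ((-1) ^+ e + a) b = S2_pt a ((-1) ^+ e + b).
Proof.
case: e; rewrite ?expr1 ?expr0; last exact: S2_pt_slide.
rewrite -[LHS]S2_ptN -[RHS]S2_ptN !opprD opprK; exact: S2_pt_slide.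
Qed.

Lemma S2_homeo_pt n a b :
  iter n (S2_homeo R) (S2_pt a b) =
  S2_pt (cat_expansion ^+ n * a) (cat_contraction ^+ n * b).
Proof.
elim: n => [|n IHn]; first by rewrite !expr0 !mul1r.
by rewrite iterS IHn S2_homeoE cat_mapE cat_lin_eigen !exprS !mulrA.
Qed.

Lemma S2_homeo_inv_pt n a b :
  iter n (homeo_inv (S2_homeo R)) (S2_pt a b) =
  S2_pt (cat_contraction ^+ n * a) (cat_expansion ^+ n * b).
Proof.
elim: n => [|n IHn]; first by rewrite !expr0 !mul1r.
rewrite iterS IHn /= (S2_lift_pi _ (@cat_map_invN R)) cat_map_invE.
by rewrite cat_lin_inv_eigen !exprS !mulrA.
Qed.

Lemma S2_pt_continuous : continuous (fun v : R * R => S2_pt v.1 v.2).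
Proof.
move=> v.
apply: (@continuous_comp _ _ _
    (fun v => pi_torus (eigen_pt v.1 v.2)) (@pi_S2 R));
  last exact: pi_continuous.
apply: (@continuous_comp _ _ _ (fun v => eigen_pt v.1 v.2) (@pi_torus R));
  last exact: pi_continuous.
have c1 : (fun w : R * R => w.1) @ v --> v.1 by exact: cvg_fst.
have c2 : (fun w : R * R => w.2) @ v --> v.2 by exact: cvg_snd.
have cM (c : R) (h : R * R -> R) (l : R) :
    h @ v --> l -> (fun w => h w * c) @ v --> l * c.
  by move=> hl; apply: cvgM => //; exact: cvg_cst.
have cD : (fun w : R * R => w.1 + w.2) @ v --> v.1 + v.2 by exact: cvgD.
have c3 : (fun w : R * R => (w.1 - w.2) / 2 + (w.1 + w.2) * s / 10) @ v -->
    (v.1 - v.2) / 2 + (v.1 + v.2) * s / 10.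
  apply: cvgD; first exact: (cM _ _ _ (cvgB c1 c2)).
  exact: (cM _ _ _ (cM _ _ _ cD)).
have c4 : (fun w : R * R => (w.1 + w.2) * s / 5) @ v --> (v.1 + v.2) * s / 5.
  exact: (cM _ _ _ (cM _ _ _ cD)).
by apply: cvg_pair c3 c4.
Qed.

(* The bounds keep [`|a - x|] and [`|a + x|] below sqrt 5, so that the second
   coordinate, less than 1 in absolute value, cannot be a nonzero integer. *)
Lemma S2_pt_inj a x : 0 < a < 11 / 10 -> 0 < x < 11 / 10 ->
  S2_pt a 0 = S2_pt x 0 -> a = x.
Proof.
have int0 (z : R) : z \is a Num.int -> `|z| < 1 -> z = 0.
  move=> /intrP[k ->]; rewrite -intr_norm -[1]/(1%:~R) ltr_int.
  by rewrite -[1]add0r ltzD1 normr_le0 => /eqP ->.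
have zero (u v : R) : pi_torus (eigen_pt u 0) = pi_torus (eigen_pt v 0) ->
    `|u - v| < 11 / 5 -> u = v.
  move=> /pi_torus_eqP/andP[_] /=; rewrite !addr0 -!mulrBl => /int0 h uv.
  have := sqrt5_gt => s5.
  suff /h/eqP : `|(u - v) * s / 5| < 1.
    by rewrite !mulf_eq0 invr_eq0; lra.
  have : `|u - v| * s < s * s by rewrite ltr_pM2r; lra.
  rewrite s2 !normrM normfV !(ger0_norm s_ge0) (ger0_norm (_ : 0 <= 5)) //; lra.
move=> ha hx /pi_S2_eqP[/zero ->//|]; first by rewrite ltr_norml; lra.
(* The opposite representative would force [x = - a], against positivity. *)
rewrite -pi_torusN.
have -> : - eigen_pt a 0 = eigen_pt (- a) 0.
  by congr pair => /=; ring.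
by move=> /zero h; have := h ltac:(rewrite ltr_norml; lra); lra.
Qed.

Lemma S2_pt_uniform (d : S2 R -> S2 R -> R) (e : R) :
    compatible_metric d -> 0 < e ->
  exists2 r, 0 < r & forall a b x y, `|a| <= 1 -> `|b| <= 1 ->
    `|x| < r -> `|y| < r -> d (S2_pt a b) (S2_pt (a + x) (b + y)) < e.
Proof.
move=> dm e0.
have K : compact (`[-1, 1] `*` `[-1, 1] : set (R * R)).
  by apply: compact_setX; exact: segment_compact.
have [r r0 h] :=
  compatible_metric_uniform _ _ _ _ _ _ _ dm K S2_pt_continuous e0.
exists r => // a b x y; rewrite !ler_norml => ha hb hx hy.
apply: (h (a, b) (a + x, b + y)).
  by split; rewrite /= in_itv.
by split; rewrite /= /ball /= opprD addNKr normrN.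
Qed.

End eigen_coordinates.

(** * Orbits close to a common orbit up to sign *)

Section shadowing.
Variables (R : realType) (M : nat).
(** Time is cut into blocks of [m] = 2 M steps. A block contracts by [mu], half a block by [c];
    expanding an error 2 [mu] for at most half a block leaves at most 2 [c]. *)
Let c : R := cat_contraction R ^+ M.
Let mu : R := c * c.
Let m : nat := (M + M)%N.
Hypothesis c_lt : 20 * c < 1.

Local Notation T := (sign_series mu).
Local Notation f := (S2_homeo R).

Let c_gt0 : 0 < c. Proof. exact/exprn_gt0/cat_contraction_gt0. Qed.

Let mu_gt0 : 0 < mu. Proof. exact: mulr_gt0. Qed.

Let mu_le_c : mu <= c.
Proof. by apply: ler_piMl; move: c_gt0 c_lt; lra. Qed.

Let mu_le : 20 * mu <= 1. Proof. by move: mu_le_c c_lt; lra. Qed.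

Let expansionXK n : cat_expansion R ^+ n * cat_contraction R ^+ n = 1.
Proof. by rewrite -exprMn cat_expansionK expr1n. Qed.

Let muE : mu = cat_contraction R ^+ m. Proof. by rewrite /mu -exprD. Qed.

Let muX : cat_expansion R ^+ m * mu = 1.
Proof. by rewrite muE expansionXK. Qed.

Let contractionX_ge0 n : 0 <= cat_contraction R ^+ n.
Proof. exact/exprn_ge0/ltW/cat_contraction_gt0. Qed.

Let contractionX_le1 n : cat_contraction R ^+ n <= 1.
Proof.
apply: exprn_ile1; first exact/ltW/cat_contraction_gt0.
by have := cat_contraction_lt R; lra.
Qed.

Let expansion_ge1 : 1 <= cat_expansion R.
Proof. by rewrite /cat_expansion; have := sqrt5_gt R; lra. Qed.

Let expansionX_ge0 n : 0 <= cat_expansion R ^+ n.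
Proof. by apply: exprn_ge0; move: expansion_ge1; lra. Qed.

Let contractionX_le n (x b : R) :
  `|x| <= b -> `|cat_contraction R ^+ n * x| <= b.
Proof.
move=> xb; rewrite normrM (ger0_norm (contractionX_ge0 n)).
by apply: le_trans xb; apply: ler_piMl.
Qed.

Let expansionX_le n (x : R) : (n <= M)%N -> `|x| <= 2 * mu ->
  `|cat_expansion R ^+ n * x| <= 2 * c.
Proof.
move=> nM xb; rewrite normrM (ger0_norm (expansionX_ge0 n)).
have -> : 2 * c = cat_expansion R ^+ M * (2 * mu).
  by rewrite /mu mulrCA (mulrA (_ ^+ _)) expansionXK mul1r.
by apply: ler_pM => //; exact: ler_weXn2l.
Qed.

Let signT_le s : `|mu * T s| <= 2 * mu.
Proof. exact: mul_sign_series_le. Qed.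

(** In each block the leading sign slides into the contracting coordinate, and the expansion shifts
    the others. Thus [p] collects the past signs, and mu (1 + 2 mu) <= 2 mu preserves its bound. *)
Lemma S2_homeo_sign_series j s : exists2 p : R, `|p| <= 2 * mu &
  iter (j * m) f (S2_pt R (T s) 0) = S2_pt R (T (fun k => s (j + k)%N)) p.
Proof.
elim: j => [|j [p pb IHj]].
  by exists 0; rewrite ?normr0 //; move: mu_gt0; lra.
exists (mu * ((-1) ^+ s j + p)).
  rewrite normrM (gtr0_norm mu_gt0) mulrC; apply: ler_wpM2r; first exact: ltW.
  by apply: le_trans (ler_normD _ _) _; rewrite normr_sign; move: mu_le; lra.
rewrite mulSn iterD IHj (sign_seriesE _ mu_gt0 mu_le) /= addn0.
rewrite S2_pt_slide_sign S2_homeo_pt mulrA -muE muX mul1r.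
by congr (S2_pt R (T _) _); apply/funext => k /=; rewrite addnS.
Qed.

(* The branch chosen by [s] shows only in the sign [e], which is erased by the
   projection to [S2]. *)
Lemma S2_homeo_shadow (n : int) : exists a b : R, [/\ `|a| <= 1, `|b| <= 1 &
  forall s, s 0%N = false -> exists (e : bool) (x y : R),
    [/\ `|x| <= 2 * c, `|y| <= 2 * c &
     iterz f n (S2_pt R (T s) 0) =
       S2_pt R ((-1) ^+ e * a + x) ((-1) ^+ e * b + y)]].
Proof.
have c2 : `|0 : R| <= 2 * c by rewrite normr0; move: c_gt0; lra.
have cmu x : `|x| <= 2 * mu -> `|x| <= 2 * c by move: mu_le_c; lra.
have n0 : `|0 : R| <= 1 by rewrite normr0.
have n1 k : `|cat_contraction R ^+ k| <= 1 by rewrite ger0_norm.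
case: n => [n|n]; last first.
  (* Backwards in time the whole series contracts; its leading term is the base point, with sign +
     by the assumption on [s 0]. *)
  exists (cat_contraction R ^+ n.+1), 0; split=> // s s0.
  exists false, (cat_contraction R ^+ n.+1 * (mu * T (s \o succn))), 0.
  split=> //.
    by apply: contractionX_le; exact: cmu.
  rewrite /iterz S2_homeo_inv_pt (sign_seriesE _ mu_gt0 mu_le) s0 expr0.
  by congr S2_pt; ring.
have [M0|m_gt0] := posnP m.
  move/eqP: M0; rewrite addn_eq0 => /andP[/eqP M0 _].
  by move: c_lt; rewrite /c M0 expr0; lra.
pose j := (n %/ m)%N; pose r := (n %% m)%N.
have nE : n = (r + j * m)%N by rewrite addnC -divn_eq.
have [rM|Mr] := leqP r M.
  (* First half of a block: the current sign has slid to the contracting side, and the later ones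
     have expanded for at most M steps. *)
  exists 0, (cat_contraction R ^+ r); split=> // s _.
  have [p pb pE] := S2_homeo_sign_series j s.
  pose t k := s (j + k)%N.
  exists (t 0%N), (cat_expansion R ^+ r * (mu * T (t \o succn))),
    (cat_contraction R ^+ r * p); split.
  - exact: expansionX_le.
  - by apply: contractionX_le; exact: cmu.
  rewrite /iterz nE iterD pE (sign_seriesE _ mu_gt0 mu_le) S2_pt_slide_sign.
  by rewrite S2_homeo_pt; congr S2_pt; rewrite /t; ring.
(* Second half: step back [q] <= M times from the end of the block, where the current sign still
   leads the expanding coordinate; now [p] is what expands. *)
pose q := (m - r)%N.
have qM : (q <= M)%N by rewrite /q leq_subLR leq_add2r ltnW.
exists (cat_contraction R ^+ q), 0; split=> // s _.
have [p pb pE] := S2_homeo_sign_series j.+1 s.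
pose t k := s (j.+1 + k)%N.
exists (t 0%N), (cat_contraction R ^+ q * (mu * T (t \o succn))),
  (cat_expansion R ^+ q * p); split.
- by apply: contractionX_le; exact: cmu.
- exact: expansionX_le.
have -> : iterz f n (S2_pt R (T s) 0) =
    iter q (homeo_inv f) (iter (j.+1 * m) f (S2_pt R (T s) 0)).
  have -> : (j.+1 * m = q + n)%N.
    by rewrite nE mulSn addnA subnK // ltnW // ltn_pmod.
  rewrite iterD; elim: q {qM} => // k IHk.
  by rewrite iterSr iterS homeoK.
rewrite pE S2_homeo_inv_pt (sign_seriesE _ mu_gt0 mu_le).
by congr S2_pt; rewrite /t; ring.
Qed.

End shadowing.

(** * The Cantor set of signed homoclinic sums *)

(* The first sign is fixed to + because [pi_S2] identifies opposite points. *)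
Definition sign_cons (s : nat -> bool) (k : nat) : bool :=
  if k is k'.+1 then s k' else false.

Theorem proposition2p2p2 (R : realType) (d : S2 R -> S2 R -> R)
    (d_metric : compatible_metric d) :
  (forall epsilon : R, 0 < epsilon ->
     exists C : set (S2 R),
       is_cantor_set C /\
       forall n : int,
         (diam d (iterz (S2_homeo R) n @` C) <= epsilon%:E)%E) /\
  (forall N : nat, (1 <= N)%N -> ~ N_expansive d (S2_homeo R) N).
Proof.
suff cantor (epsilon : R) : 0 < epsilon ->
    exists C : set (S2 R), is_cantor_set C /\
      forall n : int, (diam d (iterz (S2_homeo R) n @` C) <= epsilon%:E)%E.
  split=> // N _ [delta /cantor[C [CC Cd]]] /(_ C Cd).
  exact: cantor_set_card.
move=> e0; have e2 : 0 < epsilon / 2 by lra.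
have [r r0 near_pt] := S2_pt_uniform R d _ d_metric e2.
(* The first bound puts the errors 2 [c] within the radius of uniform continuity; the second serves
   shadowing and injectivity. *)
have [M cr c20] : exists2 M, 2 * cat_contraction R ^+ M < r &
    20 * cat_contraction R ^+ M < 1.
  have c0 := cat_contraction_gt0 R; have c1 := cat_contraction_lt R.
  have c_norm : `|cat_contraction R| < 1 by rewrite gtr0_norm //; lra.
  have b0 : 0 < Num.min (r / 2) (1 / 20) by rewrite lt_min; lra.
  have /cvgr0Pnorm_lt/(_ _ b0)[M _ /(_ M (leqnn M))] := cvg_expr c_norm.
  rewrite ger0_norm ?exprn_ge0 ?(ltW c0) // lt_min => /andP[h1 h2].
  by exists M; lra.
pose mu : R := cat_contraction R ^+ M * cat_contraction R ^+ M.
have c0 : 0 < cat_contraction R ^+ M by exact/exprn_gt0/cat_contraction_gt0.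
have mu0 : 0 < mu by exact: mulr_gt0.
have mu20 : 20 * mu < 1.
  have : mu <= cat_contraction R ^+ M by apply: ler_piMl; lra.
  lra.
pose T := sign_series mu.
have TE s : T (sign_cons s) = 1 + mu * T s.
  by rewrite /T (sign_seriesE _ mu0 (ltW mu20)) expr0.
pose g (s : cantor_space) : S2 R := S2_pt R (T (sign_cons s)) 0.
exists (range g); split.
  apply: cantor_set_range; first exact: compatible_metric_hausdorff d_metric.
    have TC : continuous (fun s : cantor_space => (1 + mu * T s, 0) : R * R).
      move=> s.
      have T1 : (fun t : cantor_space => 1 + mu * T t) @ s --> 1 + mu * T s.
        apply: cvgD; first exact: cvg_cst.
        apply: cvgM; first exact: cvg_cst.
        exact: sign_series_continuous mu0 (ltW mu20) s.
      have T2 : (fun t : cantor_space => 0 : R) @ s --> (0 : R).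
        exact: cvg_cst.
      by apply: cvg_pair T1 T2.
    rewrite (_ : g = (fun v => S2_pt R v.1 v.2) \o
        (fun s : cantor_space => (1 + mu * T s, 0) : R * R)).
      move=> s; apply: continuous_comp; first exact: TC.
      exact: S2_pt_continuous.
    by apply/funext => s; rewrite /g TE.
  (* Here 2 [mu] < 1 / 10, whence the range required by [S2_pt_inj]. *)
  have bounds s : 0 < 1 + mu * T s < 11 / 10.
    have := mul_sign_series_le mu mu0 (ltW mu20) s.
    by rewrite ler_norml -/T; lra.
  move=> s t; rewrite /g !TE => /(S2_pt_inj _ _ _ (bounds s) (bounds t)) st.
  apply: (sign_series_inj mu mu0 (ltW mu20)).
  by apply: (mulfI (lt0r_neq0 mu0)); move: st; rewrite -/T; lra.
move=> n; apply: ge_ereal_sup.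
move=> _ [[_ _] /= [[_ [s _ <-] <-] [_ [t _ <-] <-]] <-].
have [a [b [a1 b1 shadow]]] := S2_homeo_shadow R M c20 n.
(* The centre depends on [n] alone, so two points of the image are within epsilon of each other. *)
have close u : d (S2_pt R a b) (iterz (S2_homeo R) n (g u)) < epsilon / 2.
  have [e [x [y [xc yc ->]]]] := shadow (sign_cons u) erefl.
  (* Multiplying both coordinates by the sign is free on the sphere: it restores the base point (a,
     b) and leaves the sizes of the errors unchanged. *)
  rewrite -(S2_pt_sign R e (_ + _)) !mulrDr !signrMK.
  by apply: near_pt => //; rewrite normrMsign; lra.
rewrite lee_fin.
have := metric_triangular d_metric (iterz (S2_homeo R) n (g s)) (S2_pt R a b)
  (iterz (S2_homeo R) n (g t)).
have := close s; have := close t.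
by rewrite (metric_symmetric d_metric (S2_pt R a b) (iterz _ n (g s))); lra.
Qed.
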